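(* Let $t$ be a positive integer. If $G$ is a finite graph with $g_o(G)\ge 2t+1$ and $\mathrm{mad}(G)<2+\frac{1}{2t}$, then $\chi_c(G)\le 2+\frac1t$.
   Context: Graphs are finite and simple. $g_o(G)$ is the length of a shortest odd cycle in $G$ ($\infty$ if $G$ is bipartite). $\mathrm{mad}(G)=\max_{H\subseteq G}\frac{2|E(H)|}{|V(H)|}$ over nonempty subgraphs $H$. For integers $p\ge 2q\ge2$, a $(p,q)$-coloring is a map $\phi:V(G)\to\{0,\dots,p-1\}$ with $q\le|\phi(u)-\phi(v)|\le p-q$ for every edge $uv$; $\chi_c(G)=\inf\{p/q: G\text{ has a }(p,q)\text{-coloring}\}$. *)

(* Defs.v *)
From mathcomp Require Import all_boot all_order all_algebra.
From mathcomp Require Import zify.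
From mathcomp Require Import classical_sets reals ereal.

Set Implicit Arguments.
Unset Strict Implicit.
Unset Printing Implicit Defensive.

Import Order.TTheory GRing.Theory Num.Theory.

Local Open Scope ring_scope.

(* Throughout, a finite simple graph is a symmetric irreflexive relation e on
   a finite type T of vertices. *)

Definition edges (T : finType) (e : rel T) : {set {set T}} :=
  [set [set x; y]%SET | x in T, y in T & e x y]%SET.

(* H.1 is the vertex set and H.2 the edge set; H need not be induced. *)
Definition is_subgraph (T : finType) (e : rel T)
    (H : {set T} * {set {set T}}) : bool :=
  (H.2 \subset edges e) && [forall f in H.2, f \subset H.1].

(* The default value 0 of the maximum is reached by edgeless subgraphs, so it
   only matters for the graph without vertices. *)
Definition mad (R : realType) (T : finType) (e : rel T) : R :=
  \big[Num.max/0]_(H : {set T} * {set {set T}} |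
      is_subgraph e H && (H.1 != finset.set0))
    ((2 * #|H.2|)%:R / #|H.1|%:R).

Definition is_odd_cycle (T : finType) (e : rel T) (c : seq T) : Prop :=
  [/\ ucycle e c, (2 < size c)%N & odd (size c)].

(* ereal_inf of the empty set is +oo. *)
Definition odd_girth (R : realType) (T : finType) (e : rel T) : \bar R :=
  ereal_inf [set (size c)%:R%:E | c in is_odd_cycle e]%classic.

Definition pq_coloring (T : finType) (e : rel T) (p q : nat)
    (phi : T -> 'I_p) : Prop :=
  forall u v : T, e u v ->
    (q <= absz ((phi u)%:Z - (phi v)%:Z)%R <= p - q)%N.

Definition circular_ratios (R : realType) (T : finType) (e : rel T) : set R :=
  [set r : R | exists p q : nat,
    [/\ (2 <= 2 * q <= p)%N,
        exists phi : T -> 'I_p, pq_coloring e q phi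
      & r = p%:R / q%:R]]%classic.
Arguments circular_ratios R [T] e.

Definition circular_chromatic_number (R : realType) (T : finType)
    (e : rel T) : R :=
  inf (circular_ratios R e).

(* Hence inf does not take its default value 0 above. *)
Lemma has_inf_circular_ratios (R : realType) (T : finType) (e : rel T) :
  irreflexive e -> has_inf (circular_ratios R e).
Proof.
move=> eirr; split; last first.
  by exists 0 => _ [p [q [_ _ ->]]]; rewrite divr_ge0 ?ler0n.
exists ((#|T|.+2)%:R / 1%:R), #|T|.+2, 1%N; split => //.
have hT (x : T) : (enum_rank x < #|T|.+2)%N.
  by rewrite (leq_trans (ltn_ord _)) // leqW.
exists (fun x => Ordinal (hT x)) => u v euv.
have nuv : (enum_rank u : nat) <> enum_rank v.
  by move=> /val_inj /enum_rank_inj uv; move: euv; rewrite uv eirr.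
have := ltn_ord (enum_rank v); have := ltn_ord (enum_rank u).
move: nuv => /=.
move: (enum_rank u : nat) (enum_rank v : nat) => a b; move: #|_| => n.
lia.
Qed.

(* Main.v *)
(* A [(2t+1, t)]-coloring changes along each edge by [t] or [t+1] modulo
   [2t+1], so along a path of length [l <= 2t] it can reach exactly [l+1] of the
   [2t+1] colors.  Generalize to multigraphs whose edges carry lengths and
   remove vertices one at a time.  A vertex [v] can be deleted if its edges
   forbid fewer than [2t+1] colors, i.e. if the sum of [2t - l] over the edges
   at [v] is at most [2t].  A vertex of degree 2 can be suppressed, its two
   edges being merged: a loop arising in this way imposes no condition, since
   its length is even or, by the odd girth, at least [2t+1].  If every vertex
   had degree at least 3 and forbade at least [2t+1] colors, double counting
   would contradict the bound on the average degree. *)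

Require Import Defs.
From mathcomp Require Import all_boot all_order all_algebra.
From mathcomp Require Import zify.
From mathcomp Require Import classical_sets reals ereal.

Set Implicit Arguments.
Unset Strict Implicit.
Unset Printing Implicit Defensive.

Import Order.TTheory GRing.Theory Num.Theory.

Local Open Scope nat_scope.

(** * Colors reachable along a path of given length *)

(* [a + t * l + i] is the end of a walk from [a] with [i] steps [t + 1] and
   [l - i] steps [t]. *)
Definition circ_reach (t l a b : nat) : bool :=
  [exists i : 'I_l.+1, a + t * l + i == b %[mod (2 * t).+1]].

Lemma circ_reachP t l a b :
  reflect (exists2 i, i <= l & a + t * l + i = b %[mod (2 * t).+1])
          (circ_reach t l a b).
Proof.
apply: (iffP existsP) => [[i /eqP h]|[i il h]]; first by exists i; rewrite -1?ltnS.
by exists (Ordinal (n := l.+1) (m := i) il); apply/eqP.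
Qed.

(** Modulo [2t + 1], a step [t] traversed backwards is a step [t + 1], so [i] becomes [l - i]. *)
Lemma circ_reach_sym t l a b : circ_reach t l a b -> circ_reach t l b a.
Proof.
case/circ_reachP=> i il h; apply/circ_reachP; exists (l - i); first by lia.
rewrite -addnA -modnDml -h modnDml.
have -> : a + t * l + i + (t * l + (l - i)) = l * (2 * t).+1 + a by nia.
by rewrite modnMDl.
Qed.

Lemma circ_reach_split t l1 l2 a b : circ_reach t (l1 + l2) a b ->
  exists2 c, circ_reach t l1 a c & circ_reach t l2 c b.
Proof.
case/circ_reachP=> i il h.
(* Take the [t + 1] steps first; truncated [i - l1] counts those left for the second part. *)
exists (a + t * l1 + minn i l1); apply/circ_reachP.
  by exists (minn i l1); first exact: geq_minr.
exists (i - l1); first by lia.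
by rewrite -h; congr (_ %% _); nia.
Qed.

(** A step [t] and a step [t + 1] cancel, so half of each returns to the start. *)
Lemma circ_reach_even t l a : ~~ odd l -> circ_reach t l a a.
Proof.
move=> l_even; apply/circ_reachP; exists l./2; first by lia.
have -> : a + t * l + l./2 = l./2 * (2 * t).+1 + a.
  by rewrite -[in t * l](odd_double_half l) (negbTE l_even); nia.
by rewrite modnMDl.
Qed.

Lemma circ_reach_long t l a b : 2 * t <= l -> circ_reach t l a b.
Proof.
move=> tl; apply/circ_reachP.
set n := (2 * t).+1; set x := a + t * l.
(* The residue of [b - x], which is at most [2 * t] and hence at most [l]. *)
exists ((b + (n - x %% n)) %% n).
  by have := ltn_pmod (b + (n - x %% n)) (ltn0Sn (2 * t)); rewrite -/n; lia.
rewrite modnDmr -modnDml.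
have xn : x %% n <= n by rewrite ltnW ?ltn_pmod.
have -> : x %% n + (b + (n - x %% n)) = b + n by lia.
by rewrite modnDr.
Qed.

Lemma circ_reach_mod t l a b :
  circ_reach t l (a %% (2 * t).+1) (b %% (2 * t).+1) = circ_reach t l a b.
Proof.
by apply: eq_existsb => i; rewrite modn_mod -addnA modnDml addnA.
Qed.

(** The [l + 1] endpoints are consecutive and at most [2t + 1] in number, hence distinct
    residues. *)
Lemma card_circ_unreach t l a : l <= 2 * t ->
  #|[set b : 'I_(2 * t).+1 | ~~ circ_reach t l a b]| <= 2 * t - l.
Proof.
move=> lt.
pose f (i : 'I_l.+1) : 'I_(2 * t).+1 := inord ((a + t * l + i) %% (2 * t).+1).
have fE i : f i = (a + t * l + i) %% (2 * t).+1 :> nat.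
  by rewrite inordK // ltn_pmod.
have f_inj : injective f.
  move=> i j /(congr1 val); rewrite /= !fE => /eqP.
  rewrite eqn_modDl => /eqP; have := ltn_ord i; have := ltn_ord j.
  move=> jl il; rewrite !modn_small; [|lia..].
  exact: val_inj.
pose A := [set b : 'I_(2 * t).+1 | circ_reach t l a b].
have fA : [set f i | i in 'I_l.+1] \subset A.
  apply/fintype.subsetP=> _ /imsetP[i _ ->]; rewrite inE; apply/circ_reachP.
  by exists i; rewrite ?fE ?modn_mod // -ltnS.
have := subset_leq_card fA; rewrite card_imset // card_ord => lA.
have := cardsC A; rewrite card_ord.
have -> : ~: A = [set b : 'I_(2 * t).+1 | ~~ circ_reach t l a b].
  by apply/setP=> b; rewrite !inE.
lia.
Qed.

(** Union bound: an entry pairs the color of a neighbor with the length of the edge to it, and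
    together the entries forbid at most [2t] of the [2t + 1] colors. *)
Lemma circ_reach_common t (s : seq (nat * nat)) :
    all (fun x => x.2 <= 2 * t) s -> \sum_(x <- s) (2 * t - x.2) <= 2 * t ->
  exists b : nat, all (fun x => circ_reach t x.2 x.1 b) s.
Proof.
move=> s_le s_sum.
pose B r := [set b : 'I_(2 * t).+1 | has (fun x => ~~ circ_reach t x.2 x.1 b) r].
have cardB r : all (fun x => x.2 <= 2 * t) r ->
    #|B r| <= \sum_(x <- r) (2 * t - x.2).
  elim: r => [_|x r IH] /=.
    by rewrite big_nil leqn0 cards_eq0; apply/eqP/setP=> b; rewrite !inE.
  case/andP=> xt rt; rewrite big_cons.
  have -> : B (x :: r) = [set b : 'I_(2 * t).+1 | ~~ circ_reach t x.2 x.1 b] :|: B r.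
    by apply/setP=> b; rewrite !inE.
  rewrite (leq_trans (leq_card_setU _ _)) // leq_add ?IH //.
  exact: card_circ_unreach.
have /card_gt0P[b] : 0 < #|~: B s|.
  by have := cardsC (B s); have := cardB s s_le; rewrite card_ord; lia.
rewrite !inE -all_predC => /allP h; exists b; apply/allP=> x /h /=.
by rewrite negbK.
Qed.

(** * Odd cycles in closed odd walks *)

Lemma not_uniq_split (T : eqType) (s : seq T) :
  ~~ uniq s -> exists a x b d, s = a ++ x :: b ++ x :: d.
Proof.
elim: s => //= y s IH; rewrite negb_and negbK.
case/orP=> [/splitPr[b d]|/IH[a [x [b [d ->]]]]].
  by exists [::], y, b, d.
by exists (y :: a), x, b, d.
Qed.

(** A repeated vertex splits the closed walk into two shorter ones, exactly one of which is odd. *)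
Lemma odd_cycle_of_closed_walk (T : finType) (e : rel T) (c : seq T) :
    irreflexive e -> cycle e c -> odd (size c) ->
  exists2 d, is_odd_cycle e d & size d <= size c.
Proof.
move=> e_irr; have [n] := ubnP (size c); elim: n c => // n IH c cn ec oc.
have [uc|/not_uniq_split[a [x [b [d cE]]]]] := boolP (uniq c).
  exists c => //; split=> //; first by rewrite /ucycle ec.
  by case: c {cn uc} ec oc => [|x [|y [|z c]]] //=; rewrite e_irr.
move: ec; rewrite cE cycle_catC /= -catA rcons_cat cat_path /=.
case/and3P=> xb ebx xda.
move: cn oc; rewrite cE !size_cat /= size_cat /= => cn oc.
have eb : cycle e (x :: b) by rewrite /= rcons_path xb.
have eda : cycle e (x :: d ++ a) by [].
have [ob|ob] := boolP (odd (size (x :: b))).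
  have [|f fo fb] := IH _ _ eb ob; first by rewrite /=; lia.
  by exists f => //; move: fb => /=; lia.
have [||f fo fb] := IH _ _ eda.
- by rewrite /= size_cat; lia.
- by move: ob oc; rewrite /= size_cat; lia.
by exists f => //; move: fb; rewrite /= size_cat; lia.
Qed.

Definition walk (T : Type) (e : rel T) (l : nat) (u v : T) : Prop :=
  exists p, [/\ path e u p, last u p = v & size p = l].

Lemma walk_sym (T : Type) (e : rel T) l u v :
  symmetric e -> walk e l u v -> walk e l v u.
Proof.
move=> e_sym [p [ep <- <-]]; exists (rev (belast u p)).
rewrite rev_path size_rev size_belast (eq_path (e' := e)) //.
by split=> //; case: p {ep} => //= y p; rewrite rev_cons last_rcons.
Qed.

Lemma walk_cat (T : Type) (e : rel T) l1 l2 u v w :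
  walk e l1 u v -> walk e l2 v w -> walk e (l1 + l2) u w.
Proof.
move=> [p [ep <- <-]] [q [eq <- <-]]; exists (p ++ q).
by rewrite cat_path ep eq last_cat size_cat.
Qed.

Lemma closed_walk_cycle (T : Type) (e : rel T) l u :
  walk e l u u -> exists2 c, cycle e c & size c = l.
Proof.
case=> p [ep pu <-]; exists p => //.
by case: p ep pu => //= x p /andP[eux exp] pu; rewrite rcons_path exp pu.
Qed.

(** * Coloring multigraphs with edge lengths *)

Section LengthGraphs.

Variables (T : finType) (t : nat).

(* [(u, v, l)] stands for a path of length [l] between [u] and [v] whose
   interior vertices have been suppressed. *)
Implicit Types (g : T * T * nat) (E : seq (T * T * nat)) (V S : {set T}).

Definition incident (v : T) g := (v == g.1.1) || (v == g.1.2).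

Definition other (v : T) g := if v == g.1.1 then g.1.2 else g.1.1.

Definition within S g := (g.1.1 \in S) && (g.1.2 \in S).

Definition length_graph V E :=
  all (fun g => [&& within V g, g.1.1 != g.1.2 & g.2 <= 2 * t]) E.

(* For [l = 1] this is [4t |E(S)| < (4t+1) |S|], i.e. average degree below
   [2 + 1/(2t)]; in general a path of length [l] carries [l] edges and [l - 1]
   interior vertices. *)
Definition sparse V E := forall S, S \subset V -> S != finset.set0 ->
  \sum_(g <- E | within S g) ((4 * t).+1 - g.2) < (4 * t).+1 * #|S|.

Definition circ_colored (c : T -> nat) E :=
  all (fun g => circ_reach t g.2 (c g.1.1) (c g.1.2)) E.

(** Weighted handshake lemma; the absence of loops gives each edge two ends. *)
Lemma sum_incident V E (F : T * T * nat -> nat) : length_graph V E ->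
  \sum_(v in V) \sum_(g <- E | incident v g) F g = 2 * \sum_(g <- E) F g.
Proof.
move=> /allP EV; under eq_bigr do rewrite big_mkcond.
rewrite exchange_big /= big_distrr /=; apply: eq_big_seq => g /EV.
case/and3P=> /andP[g1 g2] g12 _; rewrite -big_mkcondr sum_nat_const.
have <- : #|[set g.1.1; g.1.2]| = 2 by rewrite cards2 g12.
congr (_ * _); apply: eq_card => v; rewrite !inE unfold_in /incident.
have [->|_] := eqVneq v g.1.1; first by rewrite g1.
by have [->|_] := eqVneq v g.1.2; rewrite ?g2 ?andbF.
Qed.

Lemma exists_light_vertex V E :
    V != finset.set0 -> length_graph V E -> sparse V E ->
  exists2 v, v \in V & (\sum_(g <- E | incident v g) (2 * t - g.2) <= 2 * t)
                       || (count (incident v) E == 2).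
Proof.
move=> V0 EV /(_ V (subxx V) V0) spV.
(* Split each weight [4t + 1 - l] into [2t - l], tied to forbidden colors, and [2t + 1], tied to
   degrees. *)
have EV' : \sum_(g <- E | within V g) ((4 * t).+1 - g.2) =
    \sum_(g <- E) (2 * t - g.2) + (2 * t).+1 * size E.
  rewrite -sum1_size big_distrr -big_split /= big_mkcond.
  by apply: eq_big_seq => g /(allP EV) /and3P[-> _ gt]; lia.
have sumI := sum_incident (fun g => 2 * t - g.2) EV.
have sumC := sum_incident (fun=> 1) EV.
apply/exists_inP; apply: contraLR spV => /exists_inPn noV.
rewrite -leqNgt EV'.
have {sumI} leI : (2 * t).+1 * #|V| <= 2 * \sum_(g <- E) (2 * t - g.2).
  rewrite -sumI mulnC -sum_nat_const leq_sum // => v /noV.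
  by rewrite negb_or -ltnNge => /andP[].
(* An edge forbids at most [2t] colors, so a vertex of degree at most 1 would be light. *)
have {sumC} leC : 3 * #|V| <= 2 * size E.
  rewrite -[size E]sum1_size -sumC mulnC -sum_nat_const leq_sum // => v /noV.
  rewrite negb_or -ltnNge sum1_count => /andP[sumv].
  move: sumv; rewrite -big_filter -size_filter.
  by case: [seq g <- E | _] => [|g [|g' [|g'' s]]] //=;
    rewrite ?big_nil ?big_seq1; lia.
(* The total weight is at least [(2t + 1)(1/2 + 3/2)|V| = (4t + 2)|V|]. *)
nia.
Qed.

Lemma other_spec V g v : incident v g -> within V g -> g.1.1 != g.1.2 ->
  [/\ other v g \in V, other v g != v &
      g.1 = (v, other v g) \/ g.1 = (other v g, v)].
Proof.
rewrite /incident /other /within => + /andP[g1 g2].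
case: eqP => [->|/eqP vg] /=; first by rewrite eq_sym g2; split=> //; left; case: g.1.
by move=> /eqP -> g12; rewrite g1; split=> //; right; case: g.1.
Qed.

Lemma circ_colored_extend V E (c : T -> nat) (v : T) (b : nat) :
    length_graph V E ->
    circ_colored c [seq g <- E | ~~ incident v g] ->
    (forall g, g \in E -> incident v g -> circ_reach t g.2 (c (other v g)) b) ->
  circ_colored (fun x => if x == v then b else c x) E.
Proof.
move=> /allP EV cE cv; apply/allP=> g gE.
case/and3P: (EV g gE) => gV g12 _.
have [vg|vg] := boolP (incident v g).
  have [_ ov] := other_spec vg gV g12.
  have := cv g gE vg; case=> + [] -> /=; rewrite eqxx (negbTE ov) //.
  exact: circ_reach_sym.
have := allP cE g; rewrite mem_filter vg => /(_ gE).
by move: vg; rewrite /incident negb_or ![v == _]eq_sym => /andP[/negbTE-> /negbTE->].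
Qed.

Lemma sparse_filter V V' E (a : pred (T * T * nat)) :
  V' \subset V -> sparse V E -> sparse V' [seq g <- E | a g].
Proof.
move=> V'V sp S SV S0.
apply: leq_ltn_trans (sp S (fintype.subset_trans SV V'V) S0).
rewrite big_filter_cond big_mkcond [leqRHS]big_mkcond leq_sum // => g _.
by case: (a g).
Qed.

(* Suppressing a vertex of degree 2 preserves sparsity: a set [S] containing
   both ends of the merged edge is tested against [v |: S] before merging. *)
Lemma sparse_suppress V E (v : T) g1 g2 :
    v \in V -> length_graph V E -> sparse V E ->
    [seq g <- E | incident v g] = [:: g1; g2] -> g1.2 + g2.2 <= 2 * t ->
  sparse (V :\ v)
    ((other v g1, other v g2, g1.2 + g2.2) :: [seq g <- E | ~~ incident v g]).
Proof.
move=> vV /allP EV sp Ev l12 S SV S0; rewrite big_cons.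
case: ifP => [/andP[/= uS wS]|_]; last first.
  by apply: sparse_filter sp S SV S0; rewrite subD1set.
have vS : v \notin S.
  by apply/negP => /(fintype.subsetP SV); rewrite !inE eqxx.
have gS g : g \in [:: g1; g2] -> other v g \in S -> within (v |: S) g.
  rewrite -Ev mem_filter => /andP[vg gE] oS; case/and3P: (EV g gE) => gV g12 _.
  have [_ _ [] gg] := other_spec vg gV g12;
    by rewrite /within gg !inE eqxx oS /= ?orbT.
(* Adding [v] raises the bound by [4t + 1], exactly the excess of the weights of [g1] and [g2] over
   that of the merged edge. *)
have := sp (v |: S).
rewrite -(perm_big _ (introT permPl (perm_filterC (incident v) E))).
rewrite big_cat Ev !big_cons big_nil !gS ?inE ?eqxx ?orbT //= cardsU1 vS.
have -> : v |: S != finset.set0 by apply/set0Pn; exists v; rewrite !inE eqxx.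
have -> : v |: S \subset V.
  by rewrite finset.subUset finset.sub1set vV (fintype.subset_trans SV) // subD1set.
have le : \sum_(g <- [seq g <- E | ~~ incident v g] | within S g)
    ((4 * t).+1 - g.2) <= \sum_(g <- [seq g <- E | ~~ incident v g]
    | within (v |: S) g) ((4 * t).+1 - g.2).
  rewrite big_mkcond [leqRHS]big_mkcond leq_sum // => g _.
  rewrite /within !inE; case: (g.1.1 \in S) => //; case: (g.1.2 \in S) => //=.
  by rewrite !orbT.
move=> /(_ isT isT); move: le; move: (\sum_(i <- _ | _) _) (\sum_(i <- _ | _) _).
by lia.
Qed.

Lemma length_graph_delete V E (v : T) :
  length_graph V E -> length_graph (V :\ v) [seq g <- E | ~~ incident v g].
Proof.
move=> /allP EV; apply/allP=> g; rewrite mem_filter => /andP[+ /EV].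
rewrite /incident /within !inE negb_or ![v == _]eq_sym.
by case/andP=> -> ->.
Qed.

(* Odd loops produced by suppressing vertices are excluded by [W_odd]. *)
Lemma circ_coloring_exists (W : nat -> T -> T -> Prop) V E :
    (forall l u v, W l u v -> W l v u) ->
    (forall l1 l2 u v w, W l1 u v -> W l2 v w -> W (l1 + l2) u w) ->
    (forall l u, W l u u -> odd l -> 2 * t < l) ->
    (forall g, g \in E -> W g.2 g.1.1 g.1.2) ->
    length_graph V E -> sparse V E ->
  exists c : T -> nat, circ_colored c E.
Proof.
move=> W_sym W_cat W_odd; have [n] := ubnP #|V|.
elim: n V E => // n IH V E Vn WE EV sp.
have [V0|V0] := eqVneq V finset.set0.
  exists (fun=> 0); apply/allP=> g /(allP EV) /and3P[/andP[]].
  by rewrite V0 inE.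
have [v vV] := exists_light_vertex V0 EV sp.
have Vv : #|V :\ v| < n by rewrite (cardsD1 v V) vV in Vn.
have Wf g : g \in [seq g <- E | ~~ incident v g] -> W g.2 g.1.1 g.1.2.
  by rewrite mem_filter => /andP[_ /WE].
have Ed := length_graph_delete v EV.
have spd : sparse (V :\ v) [seq g <- E | ~~ incident v g].
  by apply: sparse_filter sp; rewrite subD1set.
case/orP=> [light|/eqP deg2].
  have [c cE] := IH _ _ Vv Wf Ed spd.
  pose s := [seq (c (other v g), g.2) | g <- E & incident v g].
  have [||b /allP bs] := @circ_reach_common t s.
  - apply/allP=> _ /mapP[g + ->]; rewrite mem_filter => /andP[_ /(allP EV)].
    by case/and3P.
  - by rewrite big_map big_filter.
  exists (fun x => if x == v then b else c x).
  apply: circ_colored_extend EV cE _ => g gE vg.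
  by apply: (bs (_, _)); apply/mapP; exists g; rewrite // mem_filter vg.
case Ev: [seq g <- E | incident v g] (deg2) => [|g1 [|g2 [|]]];
  rewrite -size_filter Ev //= => _.
have gP g : g \in [:: g1; g2] ->
    [/\ other v g \in V :\ v, W g.2 (other v g) v & W g.2 v (other v g)].
  rewrite -Ev mem_filter => /andP[vg gE]; case/and3P: (allP EV g gE) => gV g12 _.
  have [oV ov gg] := other_spec vg gV g12; rewrite !inE ov oV.
  by have := WE g gE; case: gg => -> /= Wg; split=> //; apply: W_sym.
have [uV Wu _] := gP g1 (mem_head _ _).
have [wV _ Ww] : [/\ other v g2 \in V :\ v, W g2.2 (other v g2) v
    & W g2.2 v (other v g2)] by apply: gP; rewrite !inE eqxx orbT.
have Wuw := W_cat _ _ _ _ _ Wu Ww.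
(* A color for [v] comes from splitting the merged path at [v]. *)
suff [c cE cuw] : exists2 c : T -> nat,
    circ_colored c [seq g <- E | ~~ incident v g] &
    circ_reach t (g1.2 + g2.2) (c (other v g1)) (c (other v g2)).
  have [b b1 b2] := circ_reach_split cuw.
  exists (fun x => if x == v then b else c x).
  apply: circ_colored_extend EV cE _ => g gE vg.
  have : g \in [:: g1; g2] by rewrite -Ev mem_filter vg.
  by rewrite !inE => /orP[] /eqP -> //; apply: circ_reach_sym.
have [l12|l12] := leqP (2 * t) (g1.2 + g2.2).
  have [c cE] := IH _ _ Vv Wf Ed spd.
  by exists c => //; apply: circ_reach_long.
(* A merged loop is dropped: here its length is below [2t], hence even by [W_odd]. *)
have [uw|uw] := eqVneq (other v g1) (other v g2).
  have [c cE] := IH _ _ Vv Wf Ed spd.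
  exists c => //; rewrite uw; apply: circ_reach_even; apply/negP=> l_odd.
  by rewrite uw in Wuw; have := W_odd _ _ Wuw l_odd; lia.
have [|||c] := IH _ ((other v g1, other v g2, g1.2 + g2.2)
    :: [seq g <- E | ~~ incident v g]) Vv.
- by move=> g; rewrite inE => /orP[/eqP->|/Wf].
- by apply/andP; split; [rewrite /within /= uV wV uw ltnW | exact: Ed].
- by apply: sparse_suppress; rewrite // ltnW.
by case/andP=> cuw cE; exists c.
Qed.

End LengthGraphs.

(** * Translation to and from simple graphs *)

Lemma pq_coloring_of_circ_reach (T : finType) (e : rel T) (t : nat)
    (c : T -> nat) :
    (forall u v, e u v -> circ_reach t 1 (c u) (c v)) ->
  exists phi : T -> 'I_(2 * t + 1), pq_coloring e t phi.
Proof.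
move=> ce; have cn u : c u %% (2 * t).+1 < 2 * t + 1 by rewrite addn1 ltn_pmod.
exists (fun u => Ordinal (cn u)) => u v /ce; rewrite -circ_reach_mod /=.
have := cn u; have := cn v; rewrite addn1.
move: (c u %% _) (c v %% _) => a b b_lt a_lt /circ_reachP[i i1].
rewrite muln1 [RHS]modn_small //.
(* Wrapping around turns a difference [t + i] into [t + 1 - i], again [t] or [t + 1]. *)
have [lt|ge] := ltnP (a + t + i) (2 * t).+1; first by rewrite modn_small //; lia.
have -> : a + t + i = (a + t + i - (2 * t).+1) + (2 * t).+1 by lia.
by rewrite modnDr modn_small; lia.
Qed.

(** Comparing ranks selects one orientation of each edge, so that no edge is counted twice. *)
Definition edge_seq (T : finType) (e : rel T) : seq (T * T * nat) :=
  [seq (x, 1) | x <- enum [set x : T * T | e x.1 x.2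
                            && (enum_rank x.1 < enum_rank x.2)]].

Lemma mem_edge_seq (T : finType) (e : rel T) g : g \in edge_seq e ->
  [/\ e g.1.1 g.1.2, enum_rank g.1.1 < enum_rank g.1.2 & g.2 = 1].
Proof. by case/mapP=> x; rewrite mem_enum inE => /andP[ex rx] ->. Qed.

Lemma edge_seq_mem (T : finType) (e : rel T) u v :
    symmetric e -> irreflexive e -> e u v ->
  (u, v, 1) \in edge_seq e \/ (v, u, 1) \in edge_seq e.
Proof.
move=> e_sym e_irr euv.
have [lt|gt|eq] := ltngtP (enum_rank u) (enum_rank v).
- by left; apply/mapP; exists (u, v) => //; rewrite mem_enum inE /= euv.
- by right; apply/mapP; exists (v, u) => //; rewrite mem_enum inE /= e_sym euv.
by move: euv; rewrite (enum_rank_inj (val_inj eq)) e_irr.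
Qed.

(** Test [mad] on the subgraph induced by [S] and multiply by [2t]. *)
Lemma mad_edge_bound (R : realType) (T : finType) (e : rel T) (t : nat)
    (S : {set T}) :
    0 < t -> (mad R e < 2 + 1 / (2 * t)%:R)%R -> S != finset.set0 ->
  4 * t * #|[set f in edges e | f \subset S]| < (4 * t).+1 * #|S|.
Proof.
move=> t0 mad_lt S0; set F := [set f in _ | _].
have Ssub : is_subgraph e (S, F) && (S != finset.set0).
  rewrite S0 andbT; apply/andP; split.
    by apply/fintype.subsetP=> f; rewrite inE => /andP[].
  by apply/forall_inP=> f; rewrite inE => /andP[].
have := le_lt_trans (le_bigmax_cond 0%R
  (fun H : {set T} * {set {set T}} => ((2 * #|H.2|)%:R / #|H.1|%:R)%R) Ssub) mad_lt.
have S_gt0 : 0 < #|S| by rewrite card_gt0.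
rewrite /= ltr_pdivrMr ?ltr0n // mulrDl mul1r -natrM.
have t_gt0 : (0 < (2 * t)%:R :> R)%R by rewrite ltr0n; lia.
rewrite -(ltr_pM2r t_gt0) mulrDl mulrAC mulVf ?gt_eqF // mul1r -!natrM -natrD ltr_nat.
by lia.
Qed.

Lemma sparse_edge_seq (R : realType) (T : finType) (e : rel T) (t : nat) :
    0 < t -> (mad R e < 2 + 1 / (2 * t)%:R)%R ->
  sparse t [set: T] (edge_seq e).
Proof.
move=> t0 mad_lt S _ S0; apply: leq_ltn_trans (mad_edge_bound t0 mad_lt S0).
pose A := [set x : T * T | [&& e x.1 x.2, enum_rank x.1 < enum_rank x.2
                              & within S (x, 1)]].
rewrite big_map big_enum_cond /= subn1 /= sum_nat_const mulnC leq_mul2l.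
have -> : #|[pred x in [set x : T * T | e x.1 x.2
    && (enum_rank x.1 < enum_rank x.2)] | within S (x, 1)]| = #|A|.
  by apply: eq_card => x; rewrite !inE andbA.
(* The rank order makes the passage from ordered pairs to edges injective. *)
pose f (x : T * T) := [set x.1; x.2].
have f_inj : {in A &, injective f}.
  move=> [x y] [x' y']; rewrite !inE /= /f /= => /and3P[_ xy _].
  move=> /and3P[_ xy' _] /setP E.
  have := E x; have := E y; rewrite !inE !eqxx /= orbT.
  case/esym/orP=> /eqP yE; case/esym/orP=> /eqP xE; subst => //;
    by move: xy xy'; lia.
rewrite -(card_in_imset f_inj) subset_leq_card ?orbT //.
apply/fintype.subsetP=> p /imsetP[[x y]]; rewrite !inE => /and3P[/= exy _ xyS] ->.
case/andP: xyS => /= xS yS; rewrite /f /= finset.subUset !finset.sub1set xS yS.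
by rewrite /= andbT /edges; apply/imset2P; exists x y; rewrite ?inE.
Qed.

Local Open Scope ring_scope.

Theorem theorem2p5 (R : realType) (T : finType) (e : rel T)
    (e_sym : symmetric e) (e_irr : irreflexive e)
    (t : nat) (t_gt0 : (0 < t)%N)
    (girth_e : ((2 * t + 1)%:R%:E <= odd_girth R e)%E)
    (mad_e : mad R e < 2 + 1 / (2 * t)%:R) :
  circular_chromatic_number R e <= 2 + 1 / t%:R.
Proof.
(* The girth bound extends from odd cycles to closed odd walks, the form stable under merging
   paths. *)
have walk_odd l u : walk e l u u -> odd l -> (2 * t < l)%N.
  move=> w; have [c ec <-] := closed_walk_cycle w => c_odd.
  have [d d_odd] := odd_cycle_of_closed_walk e_irr ec c_odd.
  apply: leq_trans; rewrite -addn1 -(ler_nat R) -lee_fin.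
  by apply: le_trans girth_e _; apply: ereal_inf_lbound; exists d.
have [g|||c /allP cE] := @circ_coloring_exists T t (walk e) [set: T]%SET
  (edge_seq e) (fun l u v => walk_sym e_sym) (@walk_cat T e) walk_odd.
- by case/mem_edge_seq=> eg _ ->; exists [:: g.1.2]; rewrite /= eg.
- apply/allP=> g /mem_edge_seq[eg _ ->]; rewrite /within !finset.in_setT /=.
  by rewrite (contraTneq _ eg) ?muln_gt0 // => ->; rewrite e_irr.
- exact: sparse_edge_seq mad_e.
have [u v euv|phi phiP] := @pq_coloring_of_circ_reach T e t c.
  by case: (edge_seq_mem e_sym e_irr euv) => /cE //=; apply: circ_reach_sym.
have -> : 2 + 1 / t%:R = (2 * t + 1)%:R / t%:R :> R.
  by rewrite natrD natrM mulrDl mulfK // pnatr_eq0 -lt0n.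
apply: ge_inf; first by have [] := has_inf_circular_ratios R e_irr.
exists (2 * t + 1)%N, t; split=> //; last by exists phi.
lia.
Qed.
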